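(* Let $A$ be a non-degenerate evolution algebra over a field $\mathbb{K}$ with $\dim(A)=n>0$ and with a $1$-dimensional socle whose square is nonzero. Then $A\cong\mathrm{Adj}_3(B,\langle\cdot,\cdot\rangle)$ for a suitable $(n-1)$-dimensional evolution algebra $B$ with an inner product $\langle\cdot,\cdot\rangle$. Furthermore, if $\mathrm{Adj}_3(B,\langle\cdot,\cdot\rangle)$ and $\mathrm{Adj}_3(B',\langle\cdot,\cdot\rangle')$ are two algebras of this class (that is, both are non-degenerate evolution algebras with one-dimensional socle of nonzero square), then $\mathrm{Adj}_3(B,\langle\cdot,\cdot\rangle)\cong\mathrm{Adj}_3(B',\langle\cdot,\cdot\rangle')$ if and only if there is an isometric isomorphism $\beta:B\to B'$, that is, an algebra isomorphism with $\langle\beta(x),\beta(y)\rangle'=\langle x,y\rangle$ for all $x,y\in B$.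
   Context: An evolution algebra over $\mathbb{K}$ is a finite-dimensional (not necessarily associative) $\mathbb{K}$-algebra with a basis $\{e_i\}$ (a natural basis) with $e_ie_j=0$ for $i\ne j$; it is non-degenerate if $\mathrm{ann}(A)=\{x:xA=Ax=0\}=0$, equivalently $e_i^2\neq0$ for all $i$. $\mathrm{Soc}(A)$ is the sum of all minimal ideals $I$ of $A$ with $AI\neq\{0\}$. An inner product is a symmetric bilinear form. For an algebra $B$ with an inner product $\langle\cdot,\cdot\rangle:B\times B\to\mathbb{K}$ (required to be nonzero when $B\ne0$), $\mathrm{Adj}_3(B,\langle\cdot,\cdot\rangle)$ is the vector space $\mathbb{K}\times B$ with product $(\lambda,b)(\lambda',b')=(\lambda\lambda'+\langle b,b'\rangle,\ bb')$. *)

(* Defs.v *)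
From HB Require Import structures.
From mathcomp Require Import all_boot all_order all_algebra.

Set Implicit Arguments.
Unset Strict Implicit.
Unset Printing Implicit Defensive.

Import GRing.Theory.

Local Open Scope ring_scope.

(* Finite-dimensional algebras whose product is only assumed bilinear: no     *)
(* associativity, commutativity or unit.                                      *)
HB.mixin Record Vector_hasBilinearMul (K : fieldType) A of Vector K A := {
  namul : A -> A -> A;
  namul_bilinear : bilinear_for *:%R *:%R namul
}.

#[short(type="naAlgType")]
HB.structure Definition NAAlgebra (K : fieldType) :=
  { A of Vector_hasBilinearMul K A & Vector K A }.

Reserved Notation "x ** y" (at level 40, left associativity).
Notation "x ** y" := (namul x y) : ring_scope.

HB.instance Definition _ (K : fieldType) (A : naAlgType K) :=
  bilinear_isBilinear.Build K A A A *:%R *:%R (@namul K A) (@namul_bilinear K A).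

Section Algebras.
Variables (K : fieldType) (A : naAlgType K).
Implicit Types (U V I J S : {vspace A}) (x y a : A).

Definition natural_basis (e : (\dim {:A}).-tuple A) : Prop :=
  basis_of fullv e /\ forall i j, i != j -> tnth e i ** tnth e j = 0.

Definition evolution_algebra : Prop := exists e, natural_basis e.

Definition in_annihilator x : Prop := forall a, x ** a = 0 /\ a ** x = 0.

Definition nondegenerate_algebra : Prop := forall x, in_annihilator x -> x = 0.

(* By bilinearity this is the span of all the products of an element of U     *)
(* and an element of V.                                                       *)
Definition mulv U V : {vspace A} :=
  <<[seq x ** y | x <- vbasis U, y <- vbasis V]>>%VS.

Definition ideal I : Prop :=
  forall a x, x \in I -> a ** x \in I /\ x ** a \in I.

Definition minimal_ideal I : Prop :=
  [/\ ideal I, I != 0%VS &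
      forall J, ideal J -> (J <= I)%VS -> J = 0%VS \/ J = I].

(* There may be infinitely many minimal ideals; an element of their sum is an *)
(* element of the sum of finitely many of them.                               *)
Definition is_socle S : Prop :=
  forall x, x \in S <->
    exists2 s : seq {vspace A},
      forall I, I \in s -> minimal_ideal I /\ mulv fullv I != 0%VS &
      x \in (\sum_(I <- s) I)%VS.

Definition socle_line_with_nonzero_square : Prop :=
  exists S, [/\ is_socle S, \dim S = 1%N & mulv S S != 0%VS].

End Algebras.

Arguments evolution_algebra {K} A.
Arguments nondegenerate_algebra {K} A.
Arguments socle_line_with_nonzero_square {K} A.

Definition algebra_isomorphism (K : fieldType) (A B : naAlgType K)
    (f : {linear A -> B}) : Prop :=
  bijective f /\ {morph f : x y / x ** y}.

Definition isomorphic_algebras (K : fieldType) (A B : naAlgType K) : Prop :=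
  exists f : {linear A -> B}, algebra_isomorphism f.

(* The standing requirement on the form used in Adj3; it is vacuous when B is *)
(* the zero algebra, whose only form is zero.                                 *)
Definition nonzero_if_nontrivial (K : fieldType) (B : naAlgType K)
    (form : {symmetric B}) : Prop :=
  ({:B} != 0)%VS -> exists x y, form x y != 0.

Definition Adj3 (K : fieldType) (B : naAlgType K) (form : {symmetric B}) : Type :=
  (K^o * B)%type.

Section Adj3.
Variables (K : fieldType) (B : naAlgType K) (form : {symmetric B}).

HB.instance Definition _ := Vector.on (Adj3 form).

Definition adj3_mul (u v : Adj3 form) : Adj3 form :=
  (u.1 * v.1 + form u.2 v.2, u.2 ** v.2).

Lemma adj3_mul_bilinear : bilinear_for *:%R *:%R adj3_mul.
Proof.
split=> [w a u v | w a u v]; apply/pair_equal_spec; split=> /=.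
- by rewrite mulrDl linearPl /= addrACA scalerDr scalerAl.
- by rewrite linearPl.
- by rewrite mulrDr linearPr /= addrACA scalerDr scalerAr.
- by rewrite linearPr.
Qed.

HB.instance Definition _ :=
  Vector_hasBilinearMul.Build K (Adj3 form) adj3_mul_bilinear.

End Adj3.

(* Main.v *)
Require Import Defs.
From HB Require Import structures.
From mathcomp Require Import all_boot all_order all_algebra.

Set Implicit Arguments.
Unset Strict Implicit.
Unset Printing Implicit Defensive.

Local Open Scope ring_scope.

Import GRing.Theory.

(** A socle that is a line with nonzero square is an ideal, so its generator v
    satisfies v ** v = c *: v with c != 0, and u = c^-1 *: v is an idempotent
    spanning it. Since the line of u is an ideal, multiplication by u is
    x |-> phi x *: u for a linear functional phi with phi u = 1. Hence A is the
    direct sum of the line of u and of the kernel W of phi, on which u acts by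
    zero. The product of b, b' in W splits as phi (b ** b') *: u plus a
    component in W: the latter is the product of B = W, the coefficient
    phi (b ** b') is the form, and (phi x, x - phi x *: u) are the coordinates
    of x in Adj3.

    As an algebra, B is the quotient of A by the line of u. A vector of the
    natural basis on which u has a nonzero coordinate is redundant modulo u,
    and the images of the others form a natural basis of B. If the form
    vanished, W would be an ideal of A meeting the socle trivially; in a
    nondegenerate algebra such an ideal is zero ([ideal_meets_socle]), because
    an ideal of least dimension in it would contribute to the socle.

    For the classification, (1, 0) is an idempotent spanning an ideal of any
    Adj3 algebra, and an idempotent spanning an ideal always lies in the socle
    ([idempotent_mem_socle]). When the socle is a line this determines the
    idempotent ([idempotent_line_inj]), so an isomorphism maps (1, 0) to
    (1, 0). It then preserves the vectors killed by (1, 0), that is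
    the summand B, and comparing the two components of a product
    (0, x) ** (0, y) shows that its restriction is an algebra isomorphism and
    an isometry. Conversely, an isometric isomorphism extends by the identity
    on the first component. *)

(** * Ideals, socle and idempotents *)

Section ProductSpaces.
Variables (K : fieldType) (A : naAlgType K).
Implicit Types (U V W I S : {vspace A}) (x y u : A).

Lemma namulZl c x y : (c *: x) ** y = c *: (x ** y).
Proof. exact: linearZl_LR. Qed.

Lemma namulZr c x y : x ** (c *: y) = c *: (x ** y).
Proof. exact: linearZr_LR. Qed.

Lemma mulv_subvP U V W :
  reflect (forall x y, x \in U -> y \in V -> x ** y \in W) (mulv U V <= W)%VS.
Proof.
apply: (iffP span_subvP) => [UVW x y Ux Vy | UVW z].
  rewrite (coord_vbasis Ux) (coord_vbasis Vy) linear_sumlz.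
  apply: rpred_sum => i _; rewrite linear_sumr; apply: rpred_sum => j _.
  rewrite /= namulZl namulZr !rpredZ // UVW //.
  by apply: allpairs_f; apply: mem_nth; rewrite size_tuple.
by case/allpairsP=> -[x y] /= [Ux Vy ->]; apply: UVW; apply: vbasis_mem.
Qed.

(** The witnesses are found by searching the finite list of products of basis
    vectors that spans mulv U V. *)
Lemma mulv_subvPn U V W :
  ~~ (mulv U V <= W)%VS -> exists x y, [/\ x \in U, y \in V & x ** y \notin W].
Proof.
move=> nUVW.
have [/allP UVW | /allPn] :=
  boolP (all (mem W) [seq x ** y | x <- vbasis U, y <- vbasis V]).
  by case/negP: nUVW; apply/span_subvP.
case=> _ /allpairsP[[x y] /= [Ux Vy ->]] nWxy.
by exists x, y; split; rewrite // vbasis_mem.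
Qed.

Lemma ideal_sum (s : seq {vspace A}) :
  (forall I, I \in s -> ideal I) -> ideal (\sum_(I <- s) I)%VS.
Proof.
elim: s => [_ a x | I s IHs idls a x].
  by rewrite big_nil memv0 => /eqP->; rewrite linear0r linear0l mem0v.
rewrite big_cons => /memv_addP[y Iy [z sz ->]].
have [ay ya] := idls I (mem_head I s) a y Iy.
have [|az za] := IHs _ a z sz.
  by move=> J sJ; apply: idls; rewrite inE sJ orbT.
by rewrite linearDr linearDl /= !memv_add.
Qed.

Lemma socle_ideal S : is_socle S -> ideal S.
Proof.
move=> socS a x /socS[s minS sx].
have [|ax xa] := ideal_sum _ a sx; first by move=> I /minS[[]].
by split; apply/socS; exists s.
Qed.

(** A nonzero idempotent u spans a minimal ideal, being a line, and u ** u = u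
    shows that A multiplies that line nontrivially. *)
Lemma idempotent_mem_socle S u :
  is_socle S -> u ** u = u -> ideal <[u]>%VS -> u \in S.
Proof.
move=> socS uu idlu; have [-> | nz_u] := eqVneq u 0; first exact: mem0v.
apply/socS; exists [:: <[u]>%VS] => [I|]; last by rewrite big_seq1 memv_line.
rewrite inE => /eqP->; split.
  split=> // [|J _ Ju]; first by rewrite -dimv_eq0 dim_vline nz_u.
  have [->|nzJ] := eqVneq J 0%VS; [by left | right].
  by apply/eqP; rewrite eqEdim Ju dim_vline nz_u lt0n dimv_eq0.
apply: contraNneq nz_u => Au0.
have /mulv_subvP/(_ u u (memvf u) (memv_line u)) : (mulv fullv <[u]> <= 0)%VS.
  by rewrite Au0.
by rewrite uu memv0.
Qed.

(** Every nonzero ideal of a nondegenerate commutative algebra meets the socle.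
    By induction on the dimension, an ideal with trivial intersection has no
    proper nonzero subideal; were it nonzero it would be minimal, hence inside
    the socle. Subideals inherit the disjointness, so minimality is provable
    constructively although the ideals form an infinite family. *)
Lemma ideal_meets_socle S I :
    commutative (@namul K A) -> nondegenerate_algebra A -> is_socle S ->
  ideal I -> (I :&: S = 0)%VS -> I = 0%VS.
Proof.
move=> mulC nondeg socS.
have [m] := ubnP (\dim I); elim: m I => // m IHm I leIm idlI IS0.
apply/eqP/negPn/negP => nzI.
have AI : mulv fullv I != 0%VS.
  apply: contra nzI; rewrite -!subv0 => /mulv_subvP AI0.
  apply/subvP => x Ix; rewrite memv0; apply/eqP/nondeg => a.
  have /eqP ax0 : a ** x == 0 by rewrite -memv0 AI0 ?memvf.
  by rewrite mulC ax0.
have minI : minimal_ideal I.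
  split=> // J idlJ JI; have [->|neqJI] := eqVneq J I; [by right | left].
  apply: IHm => //; last first.
    by apply/eqP; rewrite -subv0 -IS0 capvS.
  rewrite -ltnS (leq_trans _ leIm) // ltnS ltn_neqAle dimvS // andbT.
  by apply: contra neqJI => /eqP dJI; rewrite eqEdim JI dJI /=.
have: (I <= S)%VS.
  apply/subvP => x Ix; apply/socS; exists [:: I]; last by rewrite big_seq1.
  by move=> J; rewrite inE => /eqP->.
by move/capv_idPl; rewrite IS0 => I0; rewrite -I0 eqxx in nzI.
Qed.

(** The square of a generator v of the socle is c *: v, as the socle is an
    ideal, and c != 0; rescaling v by c^-1 gives the idempotent. *)
Lemma socle_idempotent :
    socle_line_with_nonzero_square A ->
  exists u, [/\ u != 0, u ** u = u, ideal <[u]>%VS & is_socle <[u]>%VS].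
Proof.
case=> S [socS dimS nzSS].
have nzv : vpick S != 0 by rewrite vpick0 -dimv_eq0 dimS.
have defS : <[vpick S]>%VS = S.
  by apply/eqP; rewrite eqEdim -memvE memv_pick dim_vline nzv dimS.
move: (vpick S) nzv defS => v nzv defS; rewrite -{}defS in socS nzSS *.
have idlv := socle_ideal socS.
have [/vlineP[c vv] _] := idlv v v (memv_line v).
have nzc : c != 0.
  apply: contra nzSS => /eqP c0; rewrite -subv0; apply/mulv_subvP.
  move=> _ _ /vlineP[a ->] /vlineP[b ->].
  by rewrite namulZl namulZr vv c0 scale0r !scaler0 mem0v.
have defu : <[c^-1 *: v]>%VS = <[v]>%VS.
  apply/eqP; rewrite eqEdim !dim_vline scaler_eq0 invr_eq0 negb_or nzc nzv.
  by rewrite -memvE memvZ ?memv_line.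
exists (c^-1 *: v); rewrite defu; split=> //.
  by rewrite scaler_eq0 invr_eq0 negb_or nzc.
by rewrite namulZl namulZr vv (scalerA _ c) mulVf ?scale1r.
Qed.

End ProductSpaces.

(** * Evolution algebras *)

Section EvolutionAlgebras.
Variable K : fieldType.

Lemma evolution_of_tuple (A : naAlgType K) m (e : m.-tuple A) :
    basis_of fullv e -> (forall i j, i != j -> tnth e i ** tnth e j = 0) ->
  evolution_algebra A.
Proof.
by move=> Be; have dimA := size_basis Be; case: _ / dimA in e Be *; exists e.
Qed.

Lemma evolution_mulC (A : naAlgType K) :
  evolution_algebra A -> commutative (@namul K A).
Proof.
case=> e [Be e0] x y.
rewrite (coord_basis Be (memvf x)) (coord_basis Be (memvf y)).
rewrite !linear_sumlz; under eq_bigr do rewrite linear_sumr.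
under [RHS]eq_bigr do rewrite linear_sumr.
rewrite exchange_big; apply: eq_bigr => i _; apply: eq_bigr => j _.
rewrite /= !namulZl !namulZr !scalerA mulrC; congr (_ *: _).
by have [-> // | neq_ij] := eqVneq i j; rewrite -!tnth_nth !e0 // eq_sym.
Qed.

(** If e is a natural basis and u has a nonzero coordinate on e_k, then p e_k
    is a combination of the images of the other e_i because p u = 0. These
    span B, are dim B in number, and inherit the vanishing of their mutual
    products. *)
Lemma evolution_line_quotient (A B : naAlgType K) (p : {linear A -> B}) u :
    evolution_algebra A -> {morph p : x y / x ** y} ->
    (forall b, exists a, p a = b) -> u != 0 -> p u = 0 ->
    \dim {:B} = (\dim {:A}).-1 ->
  evolution_algebra B.
Proof.
case=> e [Be e0] pM p_surj nz_u pu0 dimB.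
have sum_u := coord_basis Be (memvf u).
have [k nz_k] : exists k, coord e k u != 0.
  apply/existsP; apply: contraR nz_u => /existsPn coord0.
  rewrite sum_u big1 // => i _.
  by have := coord0 i; rewrite negbK => /eqP->; rewrite scale0r.
pose f := [tuple p (tnth e (lift k i)) | i < (\dim {:A}).-1].
apply: (@evolution_of_tuple B _ f) => [|i j neq_ij]; last first.
  by rewrite !tnth_mktuple -pM e0 ?linear0 // (inj_eq lift_inj).
have pe i : i != k -> p (tnth e i) \in <<f>>%VS.
  rewrite eq_sym => /unlift_some[j -> _]; apply: memv_span; apply/tnthP.
  by exists j; rewrite tnth_mktuple.
have sum_p x : p x = \sum_i coord e i x *: p (tnth e i).
  rewrite {1}(coord_basis Be (memvf x)) linear_sum; apply: eq_bigr => i _.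
  by rewrite linearZ -tnth_nth.
have pek : p (tnth e k) \in <<f>>%VS.
  have := sum_p u; rewrite pu0 (bigD1 k) //= => /esym/eqP; rewrite addr_eq0.
  move=> /eqP sum_k; rewrite -(scale1r (p _)) -(mulVf nz_k) -scalerA sum_k.
  by rewrite rpredZ // rpredN rpred_sum // => i ik; rewrite rpredZ // pe.
rewrite basisEdim size_tuple dimB leqnn andbT; apply/subvP => b _.
have [a <-] := p_surj b; rewrite sum_p rpred_sum // => i _; rewrite rpredZ //.
by have [->|/pe] := eqVneq i k.
Qed.

End EvolutionAlgebras.

(** * Splitting off an idempotent that spans an ideal *)

(** The kernel of phi, to be given the product of A followed by projection
    along u. It is meant for phi with phi u = 1, but that is left out of the
    parameters so that the algebra structure depends on no proof; u is a
    parameter because the projection, hence the product, depends on it. *)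
Definition peirce_zero (K : fieldType) (A : naAlgType K) (u : A)
    (phi : 'Hom(A, K^o)) : Type := subvs_of (lker phi).

Section PeirceZero.
Variables (K : fieldType) (A : naAlgType K) (u : A) (phi : 'Hom(A, K^o)).

HB.instance Definition _ := Vector.on (peirce_zero u phi).

(** The argument of vsproj lies in the kernel of phi as soon as phi u = 1. *)
Definition peirce_proj (x : A) : peirce_zero u phi :=
  vsproj (lker phi) (x - (phi x : K) *: u).

Fact peirce_proj_is_linear : linear peirce_proj.
Proof.
move=> c x y; rewrite /peirce_proj -linearP; congr vsproj.
by rewrite linearP /= scalerDl opprD addrACA scalerBr scalerA.
Qed.

HB.instance Definition _ :=
  GRing.isSemilinear.Build K A (peirce_zero u phi) _ peirce_proj
    (GRing.semilinear_linear peirce_proj_is_linear).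

Definition peirce_zero_mul (b b' : peirce_zero u phi) :=
  peirce_proj (vsval b ** vsval b').

Fact peirce_zero_mul_bilinear : bilinear_for *:%R *:%R peirce_zero_mul.
Proof.
by split=> [w c x y | w c x y];
  rewrite /peirce_zero_mul linearP ?linearPl ?linearPr linearP.
Qed.

HB.instance Definition _ :=
  Vector_hasBilinearMul.Build K (peirce_zero u phi) peirce_zero_mul_bilinear.

(** Commutativity is an argument because the structure of symmetric form is
    attached to this constant. *)
Definition peirce_form of commutative (@namul K A) :=
  fun b b' : peirce_zero u phi => phi (vsval b ** vsval b') : K.

Variable mulC : commutative (@namul K A).

Fact peirce_form_bilinear :
  bilinear_for *%R (idfun \; *%R) (peirce_form mulC).
Proof.
by split=> [w c x y | w c x y];
  rewrite /peirce_form linearP ?linearPl ?linearPr linearP.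
Qed.

Fact peirce_form_symmetric b b' :
  peirce_form mulC b b' = (-1) ^+ false * idfun (peirce_form mulC b' b).
Proof. by rewrite mul1r /peirce_form mulC. Qed.

HB.instance Definition _ :=
  bilinear_isBilinear.Build K (peirce_zero u phi) (peirce_zero u phi) K
    *%R (idfun \; *%R) (peirce_form mulC) peirce_form_bilinear.

HB.instance Definition _ :=
  isHermitianSesquilinear.Build K (peirce_zero u phi) false idfun
    (peirce_form mulC) peirce_form_symmetric.

End PeirceZero.

Section PeirceDecomposition.
Variables (K : fieldType) (A : naAlgType K) (u : A) (phi : 'Hom(A, K^o)).
Hypothesis mulC : commutative (@namul K A).
Hypothesis nz_u : u != 0.
Hypothesis uu : u ** u = u.
Hypothesis mul_u : forall x, u ** x = (phi x : K) *: u.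

Local Notation B := (peirce_zero u phi).
Local Notation proj := (@peirce_proj K A u phi).
Local Notation form := (peirce_form (u := u) (phi := phi) mulC).

Lemma peirce_weight_idem : phi u = 1.
Proof.
apply/eqP; rewrite -subr_eq0; apply/eqP; move/eqP: (mul_u u).
by rewrite uu -{1}[u]scale1r -subr_eq0 -scalerBl scaler_eq0 (negPf nz_u) orbF
  subr_eq0 => /eqP<-; rewrite subrr.
Qed.

Lemma val_peirce_proj x : vsval (proj x) = x - (phi x : K) *: u.
Proof.
rewrite vsprojK // memv_ker linearB linearZ /= peirce_weight_idem.
by rewrite [_ *: _]mulr1 subrr.
Qed.

Lemma peirce_weight_val (b : B) : phi (vsval b) = 0.
Proof. by apply/eqP; rewrite -memv_ker subvsP. Qed.

Lemma peirce_proj_val (b : B) : proj (vsval b) = b.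
Proof.
apply: val_inj.
by rewrite /= val_peirce_proj peirce_weight_val scale0r subr0.
Qed.

Lemma peirce_proj_idem : proj u = 0.
Proof.
apply: val_inj.
by rewrite /= val_peirce_proj peirce_weight_idem scale1r subrr.
Qed.

(** The cross terms are multiples of u since u spans an ideal, so
    projecting both factors changes the product by a multiple of u only. *)
Lemma mul_val_peirce_proj x y :
  vsval (proj x) ** vsval (proj y) = x ** y - (phi x * phi y : K) *: u.
Proof.
rewrite !val_peirce_proj linearBl /= !linearBr /= !namulZl !namulZr.
by rewrite (mulC x u) uu !mul_u !scalerA subrr subr0 mulrC.
Qed.

Lemma peirce_projM : {morph proj : x y / x ** y}.
Proof.
move=> x y; rewrite /namul /= /peirce_zero_mul mul_val_peirce_proj.
by rewrite linearB linearZ /= peirce_proj_idem scaler0 subr0.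
Qed.

Lemma peirce_zero_dim : \dim {:B} = (\dim {:A}).-1.
Proof.
have phi_rank : \dim (limg phi) = 1%N.
  apply/eqP; rewrite eqn_leq (leq_trans (dimvS (subvf _))) ?dimvf //=.
  rewrite lt0n dimv_eq0.
  apply: contraTneq (memv_img phi (memvf u)) => ->.
  by rewrite memv0 peirce_weight_idem oner_eq0.
by rewrite dimvf -(limg_ker_dim phi fullv) capfv phi_rank addn1.
Qed.

Definition peirce_coords (x : A) : Adj3 form := (phi x, proj x).

Fact peirce_coords_is_linear : linear peirce_coords.
Proof. by move=> c x y; rewrite /peirce_coords !linearP. Qed.

HB.instance Definition _ :=
  GRing.isSemilinear.Build K A (Adj3 form) _ peirce_coords
    (GRing.semilinear_linear peirce_coords_is_linear).

Lemma peirce_isomorphic : isomorphic_algebras A (Adj3 form).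
Proof.
exists peirce_coords; split; last first.
  move=> x y; apply/pair_equal_spec; split; last exact: peirce_projM.
  rewrite /= /peirce_form mul_val_peirce_proj linearB linearZ /=.
  by rewrite peirce_weight_idem [_ *: 1]mulr1 addrC subrK.
exists (fun v => (v.1 : K) *: u + vsval v.2) => [x | [l b]] /=.
  by rewrite val_peirce_proj addrC subrK.
rewrite /peirce_coords !linearP /= peirce_weight_val peirce_weight_idem.
by rewrite peirce_proj_idem peirce_proj_val scaler0 add0r addr0 [_ *: _]mulr1.
Qed.

(** The projection identifies this algebra with the quotient of A by the line
    of u. *)
Lemma peirce_zero_evolution : evolution_algebra A -> evolution_algebra B.
Proof.
move=> evoA; apply: (evolution_line_quotient evoA peirce_projM _ nz_u).
- by move=> b; exists (vsval b); apply: peirce_proj_val.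
- exact: peirce_proj_idem.
- exact: peirce_zero_dim.
Qed.

(** Were the form zero, W := lker phi would be closed under the product, hence
    an ideal of A as u kills it, and it would meet the socle trivially. *)
Lemma peirce_form_neq0 :
    nondegenerate_algebra A -> is_socle <[u]>%VS -> nonzero_if_nontrivial form.
Proof.
move=> nondeg socu nzB; set W := lker phi.
have [WW | /mulv_subvPn[x [y [Wx Wy]]]] := boolP (mulv W W <= W)%VS; last first.
  rewrite memv_ker => nz_xy; exists (vsproj W x), (vsproj W y).
  by rewrite /= /peirce_form !vsprojK.
suff W0 : W = 0%VS.
  case/negP: nzB; rewrite -subv0; apply/subvP => b _.
  rewrite memv0; apply/eqP/val_inj.
  by apply/eqP; rewrite /= -memv0 -W0 subvsP.
apply: (ideal_meets_socle mulC nondeg socu).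
  suff WM a x : x \in W -> a ** x \in W by move=> a x Wx; rewrite (mulC x) WM.
  move=> Wx; rewrite -[a](subrK ((phi a : K) *: u)) -val_peirce_proj.
  rewrite linearDl /=.
  rewrite rpredD //; first by move/mulv_subvP: WW; apply; rewrite ?subvsP.
  move: Wx; rewrite memv_ker => /eqP phi0.
  by rewrite namulZl mul_u phi0 scale0r scaler0 mem0v.
apply/eqP; rewrite -subv0; apply/subvP => x.
rewrite memv_cap => /andP[Wx /vlineP[c def_x]].
move: Wx; rewrite def_x memv_ker linearZ /= peirce_weight_idem [_ *: _]mulr1.
by move/eqP->; rewrite scale0r mem0v.
Qed.

End PeirceDecomposition.

Section PeirceWeight.
Variables (K : fieldType) (A : naAlgType K) (u : A).

Definition peirce_weight (x : A) : K^o := coord [tuple u] ord0 (u ** x).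

Fact peirce_weight_is_linear : linear peirce_weight.
Proof. by move=> c x y; rewrite /peirce_weight linearPr linearP. Qed.

HB.instance Definition _ :=
  GRing.isSemilinear.Build K A K^o _ peirce_weight
    (GRing.semilinear_linear peirce_weight_is_linear).

Lemma ideal_line_mul (idlu : ideal <[u]>%VS) x :
  u ** x = (linfun peirce_weight x : K) *: u.
Proof.
have ux : u ** x \in <<[tuple u]>>%VS.
  by rewrite span_seq1; have [] := idlu x u (memv_line u).
by rewrite lfunE {1}(coord_span ux) big_ord1.
Qed.

End PeirceWeight.

(** * Isomorphisms between algebras Adj3 *)

Section Adj3Structure.
Variables (K : fieldType) (B : naAlgType K) (form : {symmetric B}).

Definition adj3_idem : Adj3 form := (1, 0).

Lemma adj3_idem_mul (v : Adj3 form) : adj3_idem ** v = (v.1, 0).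
Proof. by apply/pair_equal_spec; rewrite /= mul1r !linear0l addr0. Qed.

Lemma adj3_mul_idem (v : Adj3 form) : v ** adj3_idem = (v.1, 0).
Proof. by apply/pair_equal_spec; rewrite /= mulr1 !linear0r addr0. Qed.

Lemma scale_adj3_idem c : c *: adj3_idem = (c, 0).
Proof. by apply/pair_equal_spec; rewrite /= scaler0 [_ *: _]mulr1. Qed.

Lemma adj3_idem_neq0 : adj3_idem != 0.
Proof. by apply/eqP => /(congr1 fst) /eqP /=; rewrite oner_eq0. Qed.

Lemma adj3_idem_sqr : adj3_idem ** adj3_idem = adj3_idem.
Proof. exact: adj3_idem_mul. Qed.

Lemma adj3_idem_ideal : ideal <[adj3_idem]>%VS.
Proof.
move=> a _ /vlineP[c ->]; rewrite namulZr namulZl adj3_mul_idem adj3_idem_mul.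
by rewrite -scale_adj3_idem !memvZ ?memv_line.
Qed.

End Adj3Structure.
Arguments adj3_idem {K B} form.
Arguments adj3_idem_neq0 {K B} form.
Arguments adj3_idem_sqr {K B} form.
Arguments adj3_idem_ideal {K B} form.

(** Squares of elements of a line are multiples of the single vector v ** v,
    and each nonzero idempotent a *: v of the line forces
    a *: (v ** v) = v. *)
Lemma idempotent_line_inj (K : fieldType) (A : naAlgType K) (v x y : A) :
    x \in <[v]>%VS -> y \in <[v]>%VS -> x ** x = x -> y ** y = y ->
  x != 0 -> y != 0 -> x = y.
Proof.
move=> /vlineP[a ->] /vlineP[b ->].
rewrite !scaler_eq0 !negb_or !namulZl !namulZr.
have scaleI c : c != 0 -> c *: (c *: (v ** v)) = c *: v -> c *: (v ** v) = v.
  by move=> nz_c /(scalerI nz_c).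
move=> av bv /andP[nz_a nz_v] /andP[nz_b _].
have {}av := scaleI a nz_a av; have {}bv := scaleI b nz_b bv.
have nz_vv : v ** v != 0.
  by apply: contraNneq nz_v => vv0; rewrite -av vv0 scaler0.
have /eqP : (a - b) *: (v ** v) = 0 by rewrite scalerBl av bv subrr.
by rewrite scaler_eq0 (negPf nz_vv) orbF subr_eq0 => /eqP->.
Qed.

Lemma ideal_line_image (K : fieldType) (A B : naAlgType K)
    (f : {linear A -> B}) u :
  algebra_isomorphism f -> ideal <[u]>%VS -> ideal <[f u]>%VS.
Proof.
case=> -[g _ gK] fM idlu b _ /vlineP[c ->]; rewrite -linearZ -[b]gK -!fM.
have [] := idlu (g b) (c *: u) (memvZ c (memv_line u)).
move=> /vlineP[d ->] /vlineP[d' ->].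
by rewrite !linearZ !memvZ ?memv_line.
Qed.

Section Adj3Isomorphisms.
Variables (K : fieldType) (B B' : naAlgType K).
Variables (form : {symmetric B}) (form' : {symmetric B'}).

(** Both elements are nonzero idempotents of Adj3 form' spanning ideals, hence
    they lie in its socle, which is a line. *)
Lemma adj3_isomorphism_idem (f : {linear Adj3 form -> Adj3 form'}) :
    socle_line_with_nonzero_square (Adj3 form') -> algebra_isomorphism f ->
  f (adj3_idem form) = adj3_idem form'.
Proof.
case/socle_idempotent=> v [_ _ _ socv] isof; have [bij_f fM] := isof.
have fe : f (adj3_idem form) ** f (adj3_idem form) = f (adj3_idem form).
  by rewrite -fM adj3_idem_sqr.
apply: (@idempotent_line_inj K _ v) => //.
- apply: (idempotent_mem_socle socv fe).
  exact: ideal_line_image isof (adj3_idem_ideal form).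
- exact: (idempotent_mem_socle socv (adj3_idem_sqr form')
    (adj3_idem_ideal form')).
- exact: adj3_idem_sqr.
- by rewrite -(linear0 f) (inj_eq (bij_inj bij_f)) adj3_idem_neq0.
- exact: adj3_idem_neq0.
Qed.

Section Restriction.
Variable f : {linear Adj3 form -> Adj3 form'}.
Hypotheses (fM : {morph f : x y / x ** y}).
Hypothesis f_idem : f (adj3_idem form) = adj3_idem form'.

(** Multiplication by (1, 0) extracts the first component, and f commutes with
    it. *)
Lemma adj3_restr_fst b : (f (0, b)).1 = 0.
Proof.
have := adj3_idem_mul (f (0, b)).
rewrite -f_idem -fM adj3_idem_mul /=.
rewrite [((0 : K), (0 : B))]/(0 : Adj3 form) linear0.
by move/(congr1 fst).
Qed.

Definition adj3_restr (b : B) : B' := (f (0, b)).2.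

Fact adj3_restr_is_linear : linear adj3_restr.
Proof.
move=> c x y; rewrite /adj3_restr.
have -> : (0, c *: x + y) = c *: ((0, x) : Adj3 form) + ((0, y) : Adj3 form).
  by apply/pair_equal_spec; rewrite /= scaler0 addr0.
by rewrite linearP.
Qed.

HB.instance Definition _ :=
  GRing.isSemilinear.Build K B B' _ adj3_restr
    (GRing.semilinear_linear adj3_restr_is_linear).

Lemma adj3_restrE b : f (0, b) = (0, adj3_restr b).
Proof.
by have := adj3_restr_fst b; rewrite /adj3_restr; case: (f _) => l b' /= ->.
Qed.

Lemma adj3_isomorphismE (l : K) b : f (l, b) = (l, adj3_restr b).
Proof.
have -> : (l, b) = l *: adj3_idem form + ((0, b) : Adj3 form).
  by rewrite scale_adj3_idem; apply/pair_equal_spec; rewrite /= addr0 add0r.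
rewrite linearP f_idem scale_adj3_idem adj3_restrE.
by apply/pair_equal_spec; rewrite /= addr0 add0r.
Qed.

End Restriction.
End Adj3Isomorphisms.
Arguments adj3_restr {K B B' form form'} f b.

(** The image under f of (0, x) ** (0, y) = (form x y, x ** y) carries both
    conclusions, one in each component. *)
Lemma adj3_restr_isomorphism (K : fieldType) (B B' : naAlgType K)
    (form : {symmetric B}) (form' : {symmetric B'})
    (f : {linear Adj3 form -> Adj3 form'}) :
    algebra_isomorphism f -> f (adj3_idem form) = adj3_idem form' ->
  algebra_isomorphism (adj3_restr f) /\ isometry form' form (adj3_restr f).
Proof.
move=> [[g fK gK] fM] f_idem; have fE := adj3_isomorphismE fM f_idem.
have prodE x y : (form x y, adj3_restr f (x ** y)) =
    (form' (adj3_restr f x) (adj3_restr f y), adj3_restr f x ** adj3_restr f y).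
  have := fM (0, x) (0, y); rewrite !fE => /pair_equal_spec[/= e1 e2].
  apply/pair_equal_spec; split=> //.
  by move: e1; rewrite !mul0r !add0r.
split; last by move=> x y; case: (prodE x y).
split; last by move=> x y; case: (prodE x y).
exists (fun b' => (g (0, b')).2) => [b | b'].
  by rewrite -fE fK.
have := gK (0, b'); case: (g _) => l b; rewrite fE => -[_] //.
Qed.

Section Adj3Lift.
Variables (K : fieldType) (B B' : naAlgType K).
Variables (form : {symmetric B}) (form' : {symmetric B'}).
Variable beta : {linear B -> B'}.

Definition adj3_lift (v : Adj3 form) : Adj3 form' := (v.1, beta v.2).

Fact adj3_lift_is_linear : linear adj3_lift.
Proof. by move=> c x y; apply/pair_equal_spec; rewrite /= linearP. Qed.

HB.instance Definition _ :=
  GRing.isSemilinear.Build K (Adj3 form) (Adj3 form') _ adj3_lift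
    (GRing.semilinear_linear adj3_lift_is_linear).

Lemma adj3_lift_isomorphism :
  algebra_isomorphism beta -> isometry form' form beta ->
  algebra_isomorphism adj3_lift.
Proof.
case=> -[g bK gK] bM iso; split.
  by exists (fun v => (v.1, g v.2)) => -[l b]; rewrite /= /adj3_lift /= ?bK ?gK.
by move=> x y; apply/pair_equal_spec; rewrite /= iso bM.
Qed.

End Adj3Lift.
Arguments adj3_lift {K B B'} form form' beta v.

Theorem theorem6p20 (K : fieldType) :
  (forall (n : nat) (A : naAlgType K),
     (0 < n)%N -> \dim {:A} = n ->
     evolution_algebra A -> nondegenerate_algebra A ->
     socle_line_with_nonzero_square A ->
     exists (B : naAlgType K) (form : {symmetric B}),
       [/\ evolution_algebra B, \dim {:B} = n.-1, nonzero_if_nontrivial form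
         & isomorphic_algebras A (Adj3 form)])
  /\
  (forall (B B' : naAlgType K) (form : {symmetric B}) (form' : {symmetric B'}),
     nonzero_if_nontrivial form -> nonzero_if_nontrivial form' ->
     evolution_algebra (Adj3 form) -> nondegenerate_algebra (Adj3 form) ->
     socle_line_with_nonzero_square (Adj3 form) ->
     evolution_algebra (Adj3 form') -> nondegenerate_algebra (Adj3 form') ->
     socle_line_with_nonzero_square (Adj3 form') ->
     (isomorphic_algebras (Adj3 form) (Adj3 form') <->
      exists beta : {linear B -> B'},
        algebra_isomorphism beta /\ isometry form' form beta)).
Proof.
split=> [n A _ dimA evoA nondeg socA | B B' form form' _ _ _ _ _ _ _ soc'].
  have [u [nz_u uu idlu socu]] := socle_idempotent socA.
  have mulC := evolution_mulC evoA; have mul_u := ideal_line_mul idlu.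
  exists (peirce_zero u (linfun (peirce_weight u))), (peirce_form mulC).
  split.
  - exact: peirce_zero_evolution.
  - by rewrite peirce_zero_dim // dimA.
  - exact: peirce_form_neq0.
  - exact: peirce_isomorphic.
split=> [[f isof] | [beta [isob iso]]]; last first.
  by exists (adj3_lift form form' beta); apply: adj3_lift_isomorphism.
exists (adj3_restr f); apply: adj3_restr_isomorphism => //.
exact: adj3_isomorphism_idem.
Qed.
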